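(* Let $A\in\mathbb{R}^{n\times n}$, $B\in\mathbb{R}^{n\times m}$, $C\in\mathbb{R}^{m\times n}$, $D\in\mathbb{R}^{m\times m}$, let $P,S\in\mathbb{R}^{n\times n}$ satisfy $S^\top P=P^\top S$ and $\operatorname{rank}\begin{bmatrix} P \\ S \end{bmatrix}=n$, and let $M\in\mathbb{R}^{r\times n}$, $N\in\mathbb{R}^{r\times m}$ satisfy $$\begin{bmatrix} S^\top AP+P^\top A^\top S & S^\top B-P^\top C^\top \\ B^\top S-CP & -D-D^\top \end{bmatrix}=-\begin{bmatrix} M^\top \\ N^\top \end{bmatrix}\begin{bmatrix} M & N \end{bmatrix}.$$ Consider the Hamiltonian lift $$\begin{bmatrix} 0 & -P^\top \\ P & 0 \end{bmatrix}\begin{bmatrix} \dot z \\ \dot v \end{bmatrix}=\begin{bmatrix} P^\top A^\top v-P^\top C^\top u \\ A P z+Bu \end{bmatrix},\qquad \hat y_h=-B^\top v+CPz+(D+D^\top)u$$ of the system $P\dot z=APz+Bu$, $y=CPz+Du$, and the state space transformation $z=\bar z$, $v=\bar v+S\bar z$. Then: (a) the transformation leaves the pre-symplectic form invariant: $$\begin{bmatrix} I & S^\top \\ 0 & I \end{bmatrix}\begin{bmatrix} 0 & -P^\top \\ P & 0 \end{bmatrix}\begin{bmatrix} I & 0 \\ S & I \end{bmatrix}=\begin{bmatrix} 0 & -P^\top \\ P & 0 \end{bmatrix};$$ (b) it transforms the Hamiltonian $\mathcal H(z,v,u)=v^\top(APz+Bu)-u^\top(CPz+Du)$ into $$\bar{\mathcal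 H}(\bar z,\bar v,u)=\bar v^\top(AP\bar z+Bu)-\tfrac12(M\bar z+Nu)^\top(M\bar z+Nu);$$ (c) it transforms the Hamiltonian lift into the equivalent representation $$\begin{bmatrix} 0 & -P^\top \\ P & 0 \end{bmatrix}\begin{bmatrix} \dot{\bar z} \\ \dot{\bar v} \end{bmatrix}=\begin{bmatrix} P^\top A^\top\bar v-M^\top(M\bar z+Nu) \\ A P\bar z+Bu \end{bmatrix},\qquad \hat y_h=-B^\top\bar v+N^\top(M\bar z+Nu),$$ i.e. differentiable $(z,v)$ together with $(u,\hat y_h)$ satisfy the first system if and only if $(\bar z,\bar v)=(z,v-Sz)$ together with $(u,\hat y_h)$ satisfy the second; (d) if $D=0$, the system in (c) is the series interconnection, obtained by setting $u_a=\bar y$, $u=\bar u$, $\hat y_h=y_a$, of the system $P\dot{\bar z}=AP\bar z+B\bar u$, $\bar y=M\bar z$, with its adjoint system $P^\top\dot{\bar v}=-P^\top A^\top\bar v+M^\top u_a$, $y_a=-B^\top\bar v$.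
   Context: For a DAE system $E\dot x=Fx+Bu$, $y=Cx+Du$, its Hamiltonian lift is the system in the variables $(x,v)$ given by $\begin{bmatrix} 0 & -E^\top \\ E & 0 \end{bmatrix}\begin{bmatrix} \dot x \\ \dot v \end{bmatrix}=\begin{bmatrix} \partial H'/\partial x \\ \partial H'/\partial v \end{bmatrix}$, $y_h=-\partial H'/\partial u$, with Hamiltonian $H'(x,v,u)=v^\top(Fx+Bu)-u^\top(Cx+Du)$; the system in the claim is the case $E=P$, $F=AP$, with $C$ replaced by $CP$. The skew-symmetric (possibly degenerate) matrix $\begin{bmatrix} 0 & -P^\top \\ P & 0 \end{bmatrix}$ is called the pre-symplectic form. *)

(* Defs.v *)
From HB Require Import structures.
From mathcomp Require Import all_boot all_order all_algebra.
From mathcomp Require Import all_classical all_reals all_analysis.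
Import Order.TTheory GRing.Theory Num.Theory.
Import numFieldNormedType.Exports.

Set Implicit Arguments.
Unset Strict Implicit.
Unset Printing Implicit Defensive.

Local Open Scope classical_set_scope.
Local Open Scope ring_scope.

Definition dotp (R : realType) (k : nat) (x y : 'cV[R]_k) : R :=
  (x^T *m y) 0 0.

Definition grad (R : realType) (k : nat) (f : 'cV[R]_k -> R) (x : 'cV[R]_k) :
    'cV[R]_k :=
  \col_i 'D_(delta_mx i 0) f x.

(* The DAE system E x' = F x + B u, y = C x + D u, with m inputs, p outputs. *)
Record dae (R : realType) (n m p : nat) := Dae {
  dae_E : 'M[R]_n;
  dae_F : 'M[R]_n;
  dae_B : 'M[R]_(n, m);
  dae_C : 'M[R]_(p, n);
  dae_D : 'M[R]_(p, m) }.

(* All solution notions below are on a time domain J and include the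
   differentiability of the state trajectories on J. *)
Definition dae_sol (R : realType) (n m p : nat) (J : set R) (G : dae R n m p)
    (x : R -> 'cV[R]_n) (u : R -> 'cV[R]_m) (y : R -> 'cV[R]_p) : Prop :=
  forall t, J t ->
    [/\ derivable x t 1,
        dae_E G *m x^`()%classic t = dae_F G *m x t + dae_B G *m u t
      & y t = dae_C G *m x t + dae_D G *m u t].

(* The sign convention is the one for which the output of the Hamiltonian lift
   of G is the sum of the outputs of G and of its adjoint, for a common
   input. *)
Definition adjoint (R : realType) (n m p : nat) (G : dae R n m p) :
    dae R n p m :=
  Dae (dae_E G)^T (- (dae_F G)^T) (dae_C G)^T (- (dae_B G)^T) (dae_D G)^T.

(* The output y1 of G1 is fed to the input u2 of G2; the interconnection has
   external input u = u1 and external output y = y2. *)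
Definition series_sol (R : realType) (n1 n2 m p q : nat) (J : set R)
    (G1 : dae R n1 m p) (G2 : dae R n2 p q)
    (x1 : R -> 'cV[R]_n1) (x2 : R -> 'cV[R]_n2)
    (u : R -> 'cV[R]_m) (y : R -> 'cV[R]_q) : Prop :=
  exists (u1 : R -> 'cV[R]_m) (y1 : R -> 'cV[R]_p)
         (u2 : R -> 'cV[R]_p) (y2 : R -> 'cV[R]_q),
    [/\ dae_sol J G1 x1 u1 y1,
        dae_sol J G2 x2 u2 y2
      & forall t, J t -> [/\ u2 t = y1 t, u t = u1 t & y t = y2 t]].

Definition presymp (R : realType) (n : nat) (P : 'M[R]_n) : 'M[R]_(n + n) :=
  block_mx 0 (- P^T) P 0.

(* presymp P * (x', v') = rhs (x, v, u), y = out (x, v, u) *)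
Definition presymp_sol (R : realType) (n m : nat) (J : set R) (P : 'M[R]_n)
    (rhs : 'cV[R]_n -> 'cV[R]_n -> 'cV[R]_m -> 'cV[R]_(n + n))
    (out : 'cV[R]_n -> 'cV[R]_n -> 'cV[R]_m -> 'cV[R]_m)
    (x v : R -> 'cV[R]_n) (u y : R -> 'cV[R]_m) : Prop :=
  forall t, J t ->
    [/\ derivable x t 1, derivable v t 1,
        presymp P *m col_mx (x^`()%classic t) (v^`()%classic t) = rhs (x t) (v t) (u t)
      & y t = out (x t) (v t) (u t)].

Definition hamiltonian (R : realType) (n m : nat) (G : dae R n m m)
    (x v : 'cV[R]_n) (u : 'cV[R]_m) : R :=
  dotp v (dae_F G *m x + dae_B G *m u) - dotp u (dae_C G *m x + dae_D G *m u).

Definition ham_lift_sol (R : realType) (n m : nat) (J : set R)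
    (G : dae R n m m) (x v : R -> 'cV[R]_n) (u y : R -> 'cV[R]_m) : Prop :=
  let H := hamiltonian G in
  presymp_sol J (dae_E G)
    (fun x v u => col_mx (grad (fun x' => H x' v u) x)
                         (grad (fun v' => H x v' u) v))
    (fun x v u => - grad (fun u' => H x v u') u)
    x v u y.

(* Main.v *)
(** The quadratic form of the Lur'e equation is read off block by block: by the
    symmetry of [P^T *m S], the terms which [v = vb + S z] adds to the
    Hamiltonian and to the equations of the lift are the quadratic and linear
    forms given by the left-hand side of the equation, and the right-hand side
    turns them into [M z + N u].  For [D = 0] the lower right block gives
    [N^T *m N = 0], hence [N = 0] over the reals, and the lift is a cascade. *)

Require Import Defs.
From HB Require Import structures.
From mathcomp Require Import all_boot all_order all_algebra.
From mathcomp Require Import all_classical all_reals all_analysis.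
From mathcomp Require Import ring.
Import Order.TTheory GRing.Theory Num.Theory.
Import numFieldNormedType.Exports.

Local Open Scope classical_set_scope.
Local Open Scope ring_scope.

(** * The inner product on column vectors and Gram matrices over the reals *)

Section DotProduct.
Context {R : realType}.

Lemma dotpC k (x y : 'cV[R]_k) : dotp x y = dotp y x.
Proof. by rewrite /dotp -[x^T *m y]trmxK trmx_mul trmxK mxE. Qed.

Lemma dotpDr k (x y z : 'cV[R]_k) : dotp x (y + z) = dotp x y + dotp x z.
Proof. by rewrite /dotp mulmxDr mxE. Qed.

Lemma dotpDl k (x y z : 'cV[R]_k) : dotp (x + y) z = dotp x z + dotp y z.
Proof. by rewrite !(dotpC _ _ z) dotpDr. Qed.

Lemma dotpNr k (x y : 'cV[R]_k) : dotp x (- y) = - dotp x y.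
Proof. by rewrite /dotp mulmxN mxE. Qed.

Lemma dotpNl k (x y : 'cV[R]_k) : dotp (- x) y = - dotp x y.
Proof. by rewrite !(dotpC _ _ y) dotpNr. Qed.

Lemma dotpZr k a (x y : 'cV[R]_k) : dotp x (a *: y) = a * dotp x y.
Proof. by rewrite /dotp -scalemxAr mxE. Qed.

Lemma dotpZl k a (x y : 'cV[R]_k) : dotp (a *: x) y = a * dotp x y.
Proof. by rewrite !(dotpC _ _ y) dotpZr. Qed.

Lemma dotp_mulmxr k l (A : 'M[R]_(k, l)) x y :
  dotp x (A *m y) = dotp (A^T *m x) y.
Proof. by rewrite /dotp trmx_mul trmxK mulmxA. Qed.

Lemma dotp_mulmxl k l (A : 'M[R]_(k, l)) x y :
  dotp (A *m x) y = dotp x (A^T *m y).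
Proof. by rewrite dotp_mulmxr trmxK. Qed.

Lemma dotp_delta k (x : 'cV[R]_k) i : dotp x (delta_mx i 0) = x i 0.
Proof. by rewrite /dotp -colE !mxE. Qed.

(** Each diagonal entry of the Gram matrix is a sum of squares over one column of [A], so its
    vanishing kills that column. *)
Lemma gram_eq0 k l (A : 'M[R]_(k, l)) : A^T *m A = 0 -> A = 0.
Proof.
move=> AA0; apply/matrixP => i j; rewrite mxE.
have := congr1 (fun X : 'M[R]_l => X j j) AA0; rewrite !mxE => /eqP.
rewrite psumr_eq0 => [/allP/(_ i)|h _]; last by rewrite mxE -expr2 sqr_ge0.
by rewrite mem_index_enum mxE -expr2 sqrf_eq0 => /(_ isT)/eqP.
Qed.

End DotProduct.

(** * Derivatives of matrix products and gradients by expansion *)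

Section Derivatives.
Context {R : realType}.

Lemma is_derive_mulmx {V : normedModType R} k l p (S : 'M[R]_(k, l))
    (z : V -> 'M[R]_(l, p)) t v dz :
  is_derive t v z dz -> is_derive t v (fun s => S *m z s) (S *m dz).
Proof.
move=> [dzt <-].
have Szij i j : (fun s => (S *m z s) i j) =
    \sum_h (S i h \*: (fun s => z s h j)).
  by apply/funext => s; rewrite mxE fct_sumE.
have dz_ h j : derivable (fun s => z s h j) t v.
  by move: h j; apply/derivable_mxP.
have dSz : derivable (fun s => S *m z s) t v.
  apply/derivable_mxP => i j; rewrite Szij; apply: derivable_sum => h.
  exact: derivableZ.
apply: DeriveDef => //; rewrite derive_mx//; apply/matrixP => i j.
rewrite !mxE Szij derive_sum; last first.
  by move=> h; exact: derivableZ.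
by apply: eq_bigr => h _; rewrite derive_mx// mxE deriveZ.
Qed.

(** The difference quotient in direction [w] is [dotp g w + h * q w], which tends to [dotp g w].
    This reduces the gradients of the Hamiltonian to polynomial identities. *)
Lemma grad_quadratic k (f : 'cV[R]_k -> R) x g (q : 'cV[R]_k -> R) :
  (forall h w, f (h *: w + x) = f x + h * dotp g w + h ^+ 2 * q w) ->
  grad f x = g.
Proof.
move=> fE; apply/colP => i; rewrite mxE -dotp_delta.
set w := delta_mx i 0; apply/cvg_lim => //=.
apply: (@cvg_trans _ ((fun h : R => dotp g w + h * q w) @ 0^')).
  apply: near_eq_cvg; near=> h.
  have h0 : h != 0 by near: h; exact: nbhs_dnbhs_neq.
  by rewrite /= fE /GRing.scale /=; field; exact: h0.
have : (fun h : R => dotp g w + h * q w) @ 0^' --> dotp g w + 0 * q w.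
  by apply: cvgD; [exact: cvg_cst|apply: cvgMl; exact: cvg_within].
by rewrite mul0r addr0.
Unshelve. all: by end_near. Qed.

End Derivatives.

(** * Explicit form of the Hamiltonian lift *)

Section HamiltonianLift.
Context {R : realType}.

Lemma eq_presymp_sol n m (J : set R) (P : 'M[R]_n) rhs rhs' out out'
    (x v : R -> 'cV[R]_n) (u y : R -> 'cV[R]_m) :
  (forall x v u, rhs x v u = rhs' x v u) ->
  (forall x v u, out x v u = out' x v u) ->
  presymp_sol J P rhs out x v u y <-> presymp_sol J P rhs' out' x v u y.
Proof.
move=> rhsE outE.
by split=> sol t /sol[dx dv]; [rewrite rhsE outE|rewrite -rhsE -outE].
Qed.

Lemma presymp_mul n (P : 'M[R]_n) (x v : 'cV[R]_n) :
  presymp P *m col_mx x v = col_mx (- (P^T *m v)) (P *m x).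
Proof. by rewrite mul_block_col !mul0mx add0r addr0 mulNmx. Qed.

Context (n m : nat) (G : dae R n m m).

Lemma grad_hamiltonian_state x v u :
  grad (fun x' => hamiltonian G x' v u) x =
  (dae_F G)^T *m v - (dae_C G)^T *m u.
Proof.
(* The Hamiltonian is affine in the state, so the second-order coefficient is zero. *)
apply: (grad_quadratic _ _ _ _ (fun=> 0)) => h w; rewrite /hamiltonian.
rewrite !(mulmxDr, dotpDr, dotpDl, dotpNl) -!scalemxAr !dotpZr.
rewrite !dotp_mulmxl !trmxK; ring.
Qed.

Lemma grad_hamiltonian_costate x v u :
  grad (fun v' => hamiltonian G x v' u) v = dae_F G *m x + dae_B G *m u.
Proof.
apply: (grad_quadratic _ _ _ _ (fun=> 0)) => h w; rewrite /hamiltonian.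
rewrite !(dotpDl, dotpZl, dotpDr) !(dotpC _ w); ring.
Qed.

(** The feedthrough term is quadratic in the input; its first-order part is what symmetrizes [D] in
    the output of the lift. *)
Lemma grad_hamiltonian_input x v u :
  grad (fun u' => hamiltonian G x v u') u =
  (dae_B G)^T *m v - dae_C G *m x - (dae_D G + (dae_D G)^T) *m u.
Proof.
apply: (grad_quadratic _ _ _ _ (fun w => - dotp w (dae_D G *m w))) => h w.
rewrite /hamiltonian.
rewrite !(mulmxDr, mulmxDl, dotpDr, dotpDl, dotpNl) -!scalemxAr !(dotpZr, dotpZl).
rewrite !(dotpC _ w) !dotp_mulmxl !trmxK; ring.
Qed.

End HamiltonianLift.

(** * The shear [v = vb + S z] and the Lur'e equation, pointwise *)

Section LurePassivity.
Context {R : realType} {n m r : nat}.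
Context (A : 'M[R]_n) (B : 'M[R]_(n, m)) (C : 'M[R]_(m, n)) (D : 'M[R]_m).
Context (P S : 'M[R]_n) (M : 'M[R]_(r, n)) (N : 'M[R]_(r, m)).
Context (hPS : S^T *m P = P^T *m S)
    (hMN : block_mx (S^T *m A *m P + P^T *m A^T *m S) (S^T *m B - P^T *m C^T)
                    (B^T *m S - C *m P)               (- D - D^T)
           = - (col_mx M^T N^T *m row_mx M N)).

Lemma lure_blocks :
  [/\ S^T *m A *m P + P^T *m A^T *m S = - (M^T *m M),
      S^T *m B - P^T *m C^T = - (M^T *m N),
      B^T *m S - C *m P = - (N^T *m M)
    & D + D^T = N^T *m N].
Proof.
have := hMN; rewrite mul_col_row opp_block_mx => /eq_block_mx[-> -> ->].
by rewrite -opprD => /oppr_inj ->.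
Qed.

(** The only block that the congruence can change is the upper left one, which becomes
    [S^T *m P - P^T *m S]. *)
Lemma presymp_shear :
  block_mx 1%:M S^T 0 1%:M *m presymp P *m block_mx 1%:M 0 S 1%:M = presymp P.
Proof.
rewrite /presymp !mulmx_block !(mul1mx, mul0mx, mulmx0, mulmx1, add0r, addr0).
by rewrite mulNmx hPS subrr.
Qed.

Lemma hamiltonian_shear (z v : 'cV[R]_n) (u : 'cV[R]_m) :
  hamiltonian (Dae P (A *m P) B (C *m P) D) z (v + S *m z) u =
  dotp v (A *m P *m z + B *m u)
  - 2^-1 * dotp (M *m z + N *m u) (M *m z + N *m u).
Proof.
have [E11 E12 _ E22] := lure_blocks.
(* The square of [M z + N u] is split into its three parts, one per block. In [zz] and [uu] the two
   summands of the block are mutually transposed and give the same scalar, hence the factor 2. *)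
have zz : dotp (M *m z) (M *m z) = - (2 * dotp (S *m z) (A *m P *m z)).
  have SAP : dotp z (S^T *m A *m P *m z) = dotp (S *m z) (A *m P *m z).
    by rewrite dotp_mulmxl !mulmxA.
  have PAS : dotp z (P^T *m A^T *m S *m z) = dotp (S *m z) (A *m P *m z).
    by rewrite -trmx_mul -mulmxA -dotp_mulmxl dotpC.
  rewrite dotp_mulmxl mulmxA -[M^T *m M]opprK -E11 mulNmx dotpNr mulmxDl dotpDr.
  by rewrite SAP PAS; ring.
have zu : dotp (M *m z) (N *m u) =
    dotp u (C *m P *m z) - dotp (S *m z) (B *m u).
  have SB : dotp z (S^T *m B *m u) = dotp (S *m z) (B *m u).
    by rewrite dotp_mulmxl mulmxA.
  have PC : dotp z (P^T *m C^T *m u) = dotp u (C *m P *m z).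
    by rewrite -trmx_mul -dotp_mulmxl dotpC.
  rewrite dotp_mulmxl mulmxA -[M^T *m N]opprK -E12 mulNmx mulmxBl dotpNr dotpDr.
  by rewrite dotpNr SB PC; ring.
have uu : dotp (N *m u) (N *m u) = 2 * dotp u (D *m u).
  rewrite dotp_mulmxl mulmxA -E22 mulmxDl dotpDr -dotp_mulmxl.
  by rewrite (dotpC _ (D *m u)); ring.
rewrite /hamiltonian /= !dotpDl !dotpDr (dotpC _ (N *m u)) zz zu uu.
by field.
Qed.

(** The two upper blocks cancel [P^T A^T S z] and leave [S^T] times the right-hand side of the state
    equation, a form in which that equation can be substituted. *)
Lemma lift_costate_shear (z v : 'cV[R]_n) (u : 'cV[R]_m) :
  P^T *m A^T *m (v - S *m z) - M^T *m (M *m z + N *m u) =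
  P^T *m A^T *m v - P^T *m C^T *m u + S^T *m (A *m P *m z + B *m u).
Proof.
have [E11 E12 _ _] := lure_blocks.
rewrite !mulmxDr mulmxN !mulmxA opprD -!(mulNmx (M^T *m _)) -E11 -E12.
rewrite !mulmxDl mulNmx -[LHS]addrA -[RHS]addrA; congr (_ + _).
rewrite [X in _ + (X + _)]addrC -!addrA addKr.
by rewrite [RHS]addrC addrA.
Qed.

Lemma lift_output_shear (z v : 'cV[R]_n) (u : 'cV[R]_m) :
  - (B^T *m (v - S *m z)) + N^T *m (M *m z + N *m u) =
  - (B^T *m v) + C *m P *m z + (D + D^T) *m u.
Proof.
have [_ _ E21 ->] := lure_blocks.
rewrite !mulmxDr mulmxN !mulmxA opprB -[N^T *m M]opprK -E21 mulNmx mulmxBl opprB.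
by rewrite addrA; congr (_ + _); rewrite addrC subrKA addrC.
Qed.

(** The shear adds [P^T S dz = S^T P dz] to the costate row. The state row, common to both systems,
    turns this into [S^T (A P z + B u)], exactly the excess found in [lift_costate_shear]. *)
Lemma lift_costate_eq_shear (z dz v dv : 'cV[R]_n) (u : 'cV[R]_m) :
  presymp P *m col_mx dz dv =
    col_mx (P^T *m A^T *m v - P^T *m C^T *m u) (A *m P *m z + B *m u) <->
  presymp P *m col_mx dz (dv - S *m dz) =
    col_mx (P^T *m A^T *m (v - S *m z) - M^T *m (M *m z + N *m u))
           (A *m P *m z + B *m u).
Proof.
rewrite lift_costate_shear !presymp_mul mulmxBr opprB (mulmxA P^T S) -hPS -(mulmxA S^T).
rewrite (addrC _ (- (P^T *m dv))).
split=> /eq_col_mx[E1 E2]; first by rewrite E1 E2.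
by move: E1; rewrite E2 => /addIr ->.
Qed.

End LurePassivity.

(** * The shear along trajectories, and the theorem *)

Lemma shear_derivative {R : realType} {n : nat} (S : 'M[R]_n)
    (z v : R -> 'cV[R]_n) t :
  derivable z t 1 ->
  (derivable v t 1 <-> derivable (fun s => v s - S *m z s) t 1) /\
  (derivable v t 1 ->
   (fun s => v s - S *m z s)^`()%classic t =
   v^`()%classic t - S *m z^`()%classic t).
Proof.
move=> dz; have dSz := is_derive_mulmx _ _ _ S _ _ _ _ (derivableP dz).
have dSz' : derivable (fun s => S *m z s) t 1 by case: dSz.
have vbE : (fun s => v s - S *m z s) = v - (fun s => S *m z s) by [].
split; last first.
  move=> dv; rewrite !derive1E vbE (deriveB dv dSz').
  by case: dSz => _ ->.
(* Subtracting or adding back the differentiable curve [S *m z] preserves differentiability, so both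
   costates are differentiable together. *)
rewrite vbE; split=> dv; first exact: (derivableB dv dSz').
have -> : v = v - (fun s => S *m z s) + (fun s => S *m z s) by rewrite subrK.
exact: (derivableD dv dSz').
Qed.

Theorem mainTheorem5 (R : realType) (n m r : nat)
    (A : 'M[R]_n) (B : 'M[R]_(n, m)) (C : 'M[R]_(m, n)) (D : 'M[R]_m)
    (P S : 'M[R]_n) (M : 'M[R]_(r, n)) (N : 'M[R]_(r, m))
    (hPS : S^T *m P = P^T *m S)
    (hrank : \rank (col_mx P S) = n)
    (hMN : block_mx (S^T *m A *m P + P^T *m A^T *m S) (S^T *m B - P^T *m C^T)
                    (B^T *m S - C *m P)               (- D - D^T)
           = - (col_mx M^T N^T *m row_mx M N)) :
  let G := Dae P (A *m P) B (C *m P) D in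
  let lift (J : set R) z v u yh :=
    presymp_sol J P
      (fun z v u => col_mx (P^T *m A^T *m v - P^T *m C^T *m u)
                           (A *m P *m z + B *m u))
      (fun z v u => - (B^T *m v) + C *m P *m z + (D + D^T) *m u)
      z v u yh in
  let newlift (J : set R) z v u yh :=
    presymp_sol J P
      (fun z v u => col_mx (P^T *m A^T *m v - M^T *m (M *m z + N *m u))
                           (A *m P *m z + B *m u))
      (fun z v u => - (B^T *m v) + N^T *m (M *m z + N *m u))
      z v u yh in
  [/\ (* the displayed system is the Hamiltonian lift of G *)
      forall J : set R, open J ->
        forall (z v : R -> 'cV[R]_n) (u yh : R -> 'cV[R]_m),
        ham_lift_sol J G z v u yh <-> lift J z v u yh,
      (* (a) *)
      block_mx 1%:M S^T 0 1%:M *m presymp P *m block_mx 1%:M 0 S 1%:M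
        = presymp P,
      (* (b) *)
      forall (zb vb : 'cV[R]_n) (u : 'cV[R]_m),
        hamiltonian G zb (vb + S *m zb) u
        = dotp vb (A *m P *m zb + B *m u)
          - 2^-1 * dotp (M *m zb + N *m u) (M *m zb + N *m u),
      (* (c) *)
      forall J : set R, open J ->
        forall (z v : R -> 'cV[R]_n) (u yh : R -> 'cV[R]_m),
        lift J z v u yh <-> newlift J z (fun t => v t - S *m z t) u yh
    & (* (d) *)
      D = 0 ->
      let G1 := Dae P (A *m P) B M (0 : 'M[R]_(r, m)) in
      let Ga := Dae P^T (- (P^T *m A^T)) M^T (- B^T) (0 : 'M[R]_(m, r)) in
      Ga = adjoint G1 /\
      forall J : set R, open J ->
        forall (zb vb : R -> 'cV[R]_n) (u yh : R -> 'cV[R]_m),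
        newlift J zb vb u yh <-> series_sol J G1 Ga zb vb u yh].
Proof.
move=> G lift newlift; have [_ _ _ E22] := lure_blocks _ _ _ _ _ _ _ _ hMN.
split.
- move=> J _ z v u yh; apply: eq_presymp_sol => {}z {}v {}u.
  + rewrite grad_hamiltonian_state grad_hamiltonian_costate /=.
    by rewrite !trmx_mul.
  + by rewrite grad_hamiltonian_input /= !opprD !opprK.
- exact: presymp_shear.
- move=> z v u; exact: hamiltonian_shear.
- move=> J _ z v u yh.
  split=> sol t /sol[dz dv E y_eq]; have [dvE dvbE] := shear_derivative S z v t dz.
  + split; [exact: dz|exact: dvE.1 dv| |].
      by rewrite (dvbE dv);
        apply/(lift_costate_eq_shear _ _ _ D _ _ _ _ hPS hMN).
    by rewrite y_eq -(lift_output_shear A _ C D P S M N hMN).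
  + have dv' := dvE.2 dv; split; [exact: dz|exact: dv'| |].
      apply/(lift_costate_eq_shear _ _ _ D _ _ _ _ hPS hMN).
      by rewrite -(dvbE dv').
    by rewrite y_eq (lift_output_shear A _ C D P S M N hMN).
- move=> D0 G1 Ga; have N0 : N = 0.
    by apply: gram_eq0; rewrite -E22 D0 trmx0 addr0.
  split; first by rewrite /Ga /adjoint /= trmx0 trmx_mul.
  move=> J _ z v u yh; split=> [sol|[u1 [y1 [u2 [y2 [sol1 sol2 con]]]]]].
  (* The link signal is forced: it is the output [M z] of the first system, fed unchanged to the
     adjoint. *)
  + exists u, (fun t => M *m z t), (fun t => M *m z t), yh.
    split=> [t|t|//] /sol[dz dv]; rewrite presymp_mul => /eq_col_mx[E1 E2] yE.
    * split; [exact: dz|exact: E2|by rewrite /= mul0mx addr0].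
    * split; [exact: dv| |rewrite /= mul0mx addr0].
      (* The costate row of the pre-symplectic form carries [- P^T], so it is the adjoint state
         equation with its sign reversed. *)
      - apply: oppr_inj; rewrite /= E1 N0 mul0mx addr0 mulNmx.
        by rewrite opprD opprK.
      - by rewrite yE N0 trmx0 mul0mx addr0 mulNmx.
  + move=> t Jt; have [dz E1 yE1] := sol1 t Jt; have [dv E2 yE2] := sol2 t Jt.
    (* The coupling relations eliminate [u1], [u2] and [y2]; then [yE1] replaces [y1] by [M z]. *)
    have [cu uE yE] := con t Jt; move: E1 yE1 E2 yE2 => /=.
    rewrite -uE -yE cu !mul0mx !addr0 => E1 yE1 E2 yE2.
    split; [exact: dz|exact: dv| |].
      rewrite presymp_mul E1 E2 yE1 N0 mul0mx addr0 mulNmx.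
      by rewrite opprD opprK.
    by rewrite yE2 N0 trmx0 mul0mx addr0 mulNmx.
Qed.
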